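(* Let $\mathcal{M}_1,\dots,\mathcal{M}_n$ be compatible interface transition systems and $\mathcal{C}=\mathcal{M}_1\otimes\dots\otimes\mathcal{M}_n$ their asynchronous composition. Then for every $1\le i\le n$: $\{Pr_i(\pi)\mid \pi\in\mathcal{L}(\mathcal{C})\}\subseteq\mathcal{L}(\mathcal{M}_i)$.
   Context: Traces: given disjoint sets of input variables $V^I$ and output variables $V^O$, a trace over $(V^I,V^O)$ is a nonempty finite or infinite sequence $\pi=s_0s_1\cdots$ of assignments to $V^I\cup V^O$, except that if $\pi$ is finite its last assignment is defined only on $V^O$; $|\pi|$ is its length. For an assignment $s$ and a set $U$ of variables, $s|_U$ is its restriction to $U$. An interface transition system (ITS) $\mathcal{M}=\langle V^I,V^O,\mathcal I,\mathcal T,\mathcal{SF}\rangle$ consists of disjoint sets $V^I$ (inputs) and $V^O$ (outputs), $V:=V^I\cup V^O$, an initial condition $\mathcal I$ (first-order formula over $V^O$), a transition condition $\mathcal T$ (first-order formula over $V\cup\{v':v\in V^O\}$, primed copies denoting next values), and a set $\mathcal{SF}$ of pairs $\langle f_A,f_G\rangle$ of formulas over $V$ (strong fairness). A trace of $\mathcal M$ is a trace $\pi=s_0s_1\cdots$ over $(V^I,V^O)$ with $s_0\models\mathcal I$, $s_k\cup s'_{k+1}\models\mathcal T$ for all $k<|\pi|-1$ (where $s'_{k+1}$ gives $v'$ the value $s_{k+1}(v)$), and, if $\pi$ is infinite, for each $\langle f_A,f_G\rangle\in\mathcal{SF}$: if $f_A$ holds at infinitely many positions then $f_G$ holds at infinitely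 many positions. $\mathcal L(\mathcal M)$ is the set of all finite and infinite traces of $\mathcal M$. ITSs $\mathcal M_1,\dots,\mathcal M_n$ are compatible if for all $i\ne j$, $V_i\cap V_j=(V^O_i\cap V^I_j)\cup(V^I_i\cap V^O_j)$. Asynchronous composition: for compatible $\mathcal M_1,\dots,\mathcal M_n$ and fresh Boolean variables $run_1,\dots,run_n,end_1,\dots,end_n$, $\mathcal M_1\otimes\dots\otimes\mathcal M_n=\langle V^I,V^O,\bigwedge_j\mathcal I_j,\mathcal T,\mathcal{SF}\rangle$ where, with $W:=\bigcup_{j<k}(V_j\cap V_k)$: $V^I=\big(\bigcup_j(V^I_j\cup\{run_j\})\big)\setminus W$, $V^O=\bigcup_j(V^O_j\cup\{end_j\})\cup W$, $\mathcal T=\bigwedge_j\big((run_j\to\mathcal T_j)\wedge(\neg run_j\to\bigwedge_{v\in V^O_j}v=v')\wedge(end_j\leftrightarrow(end_j'\wedge\neg run_j))\big)$, $\mathcal{SF}=\bigcup_j\big(\{\langle\top,run_j\vee end_j\rangle\}\cup\{\langle run_j\wedge f_A,run_j\wedge f_G\rangle:\langle f_A,f_G\rangle\in\mathcal{SF}_j\}\big)$. Projection: fix $i$. For a trace $\pi=s_0s_1\cdots$ of $\mathcal C$ let $r_0<r_1<\cdots$ enumerate the positions at which $run_i$ is true. If there are infinitely many, $Pr_i(\pi):=s_{r_0}|_{V_i}\,s_{r_1}|_{V_i}\cdots$. Otherwise, with $N\ge0$ such positions, let $m:=r_{N-1}+1$ ($m:=0$ if $N=0$) and $Pr_i(\pi):=s_{r_0}|_{V_i}\cdots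 s_{r_{N-1}}|_{V_i}\,s_m|_{V^O_i}$ (a finite trace of length $N+1$ over $(V^I_i,V^O_i)$). *)

(* Defs.v *)
From HB Require Import structures.
From mathcomp Require Import all_boot finmap.
From mathcomp Require Import all_classical.

Set Implicit Arguments.
Unset Strict Implicit.
Unset Printing Implicit Defensive.

Local Open Scope classical_set_scope.

Inductive srt (S : Type) := SBool | SUser of S.
Arguments SBool {S}.

(* Relation symbols are function symbols with value sort [SBool]. *)
Record signature := Signature {
  usort : Type;
  fsym : Type;
  farity : fsym -> nat;
  fdom : forall f, 'I_(farity f) -> srt usort;
  fcod : fsym -> srt usort }.

Definition dom_of (S : Type) (U : S -> Type) (s : srt S) : Type :=
  match s with SBool => bool | SUser u => U u end.

Record structure (Sg : signature) := Structure {
  udom : usort Sg -> Type;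
  udom_inhabited : forall u, inhabited (udom u);
  fint : forall f : fsym Sg,
    (forall i : 'I_(farity f), dom_of udom (fdom i)) -> dom_of udom (fcod f) }.

Definition dom (Sg : signature) (D : structure Sg) : srt (usort Sg) -> Type :=
  dom_of (@udom Sg D).

(* Formulas are parametrized by a family [X] of variables, [X s] being the
   type of the variables of sort [s] that may occur free. *)
Inductive term (Sg : signature) (X : srt (usort Sg) -> Type) :
    srt (usort Sg) -> Type :=
| tvar s : X s -> term X s
| tapp (f : fsym Sg) :
    (forall i : 'I_(farity f), term X (fdom i)) -> term X (fcod f).

Inductive ext (Sg : signature) (X : srt (usort Sg) -> Type)
    (s : srt (usort Sg)) : srt (usort Sg) -> Type :=
| ext_old t : X t -> ext X s t
| ext_new : ext X s s.

Inductive formula (Sg : signature) (X : srt (usort Sg) -> Type) : Type :=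
| ftrue
| fatom of term X SBool
| feq s of term X s & term X s
| fnot of formula X
| fand of formula X & formula X
| for_ of formula X & formula X
| fimp of formula X & formula X
| fall s of formula (ext X s)
| fex s of formula (ext X s).
Arguments ftrue {Sg X}.

Definition fiff Sg (X : srt (usort Sg) -> Type) (p q : formula X) :=
  fand (fimp p q) (fimp q p).

Definition valuation Sg (D : structure Sg) (X : srt (usort Sg) -> Type) :=
  forall s, X s -> dom D s.

Fixpoint eval Sg (D : structure Sg) X (rho : valuation D X) s (t : term X s) :
    dom D s :=
  match t with
  | tvar _ x => rho _ x
  | tapp f a => fint (fun i => eval rho (a i))
  end.

Definition vext Sg (D : structure Sg) X (rho : valuation D X) s (d : dom D s) :
    valuation D (ext X s) :=
  fun t x => match x in ext _ _ t return dom D t with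
             | ext_old _ y => rho _ y
             | ext_new => d
             end.

Fixpoint sat Sg (D : structure Sg) X (rho : valuation D X) (p : formula X) :
    Prop :=
  match p with
  | ftrue => True
  | fatom t => eval rho t = true :> bool
  | feq _ t u => eval rho t = eval rho u
  | fnot q => ~ sat rho q
  | fand q r => sat rho q /\ sat rho r
  | for_ q r => sat rho q \/ sat rho r
  | fimp q r => sat rho q -> sat rho r
  | fall s q => forall d : dom D s, sat (vext rho d) q
  | fex s q => exists d : dom D s, sat (vext rho d) q
  end.

Fixpoint trename Sg (X Y : srt (usort Sg) -> Type) (h : forall s, X s -> Y s)
    s (t : term X s) : term Y s :=
  match t with
  | tvar _ x => tvar (h _ x)
  | tapp f a => tapp (fun i => trename h (a i))
  end.

Definition ext_map Sg (X Y : srt (usort Sg) -> Type) (h : forall s, X s -> Y s)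
    s t (x : ext X s t) : ext Y s t :=
  match x with
  | ext_old _ y => ext_old s (h _ y)
  | ext_new => ext_new Y s
  end.

Fixpoint frename Sg (X Y : srt (usort Sg) -> Type) (h : forall s, X s -> Y s)
    (p : formula X) : formula Y :=
  match p with
  | ftrue => ftrue
  | fatom t => fatom (trename h t)
  | feq _ t u => feq (trename h t) (trename h u)
  | fnot q => fnot (frename h q)
  | fand q r => fand (frename h q) (frename h r)
  | for_ q r => for_ (frename h q) (frename h r)
  | fimp q r => fimp (frename h q) (frename h r)
  | fall s q => fall (frename (ext_map h (s := s)) q)
  | fex s q => fex (frename (ext_map h (s := s)) q)
  end.

(* [vin vsort U s] is the type of the variables of sort [s] in the set [U];
   carrying the sort equation in the element avoids casts. *)
Record vin (Sg : signature) (var : choiceType) (vsort : var -> srt (usort Sg))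
    (U : set var) (s : srt (usort Sg)) := Vin {
  vin_var : var;
  vin_mem : U vin_var;
  vin_sort : vsort vin_var = s }.
Arguments Vin {Sg var vsort U s}.

Definition vin_sub Sg (var : choiceType) (vsort : var -> srt (usort Sg))
    (U W : set var) (UW : U `<=` W) s (x : vin vsort U s) : vin vsort W s :=
  Vin (vin_var x) (UW _ (vin_mem x)) (vin_sort x).

Definition asg Sg (D : structure Sg) (var : choiceType)
    (vsort : var -> srt (usort Sg)) (U : set var) :=
  valuation D (vin vsort U).

Definition restr Sg (D : structure Sg) (var : choiceType)
    (vsort : var -> srt (usort Sg)) (U W : set var) (UW : U `<=` W)
    (s : asg D vsort W) : asg D vsort U :=
  fun t x => s t (vin_sub UW x).

(* The variables of [U] together with the primed copies of those of [W]. *)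
Definition vprimed Sg (var : choiceType) (vsort : var -> srt (usort Sg))
    (U W : set var) (s : srt (usort Sg)) : Type :=
  (vin vsort U s + vin vsort W s)%type.

Definition vjoin Sg (D : structure Sg) (var : choiceType)
    (vsort : var -> srt (usort Sg)) (U W : set var)
    (s : asg D vsort U) (s' : asg D vsort W) :
    valuation D (vprimed vsort U W) :=
  fun t x => match x with inl y => s t y | inr y => s' t y end.

Definition vprimed_sub Sg (var : choiceType) (vsort : var -> srt (usort Sg))
    (U U' W W' : set var) (UU' : U `<=` U') (WW' : W `<=` W') s
    (x : vprimed vsort U W s) : vprimed vsort U' W' s :=
  match x with inl y => inl (vin_sub UU' y) | inr y => inr (vin_sub WW' y) end.

(* [fin_trace l o] is the finite trace of length [(size l).+1] whose last
   assignment [o] is defined on the output variables only. *)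
Inductive trace Sg (D : structure Sg) (var : choiceType)
    (vsort : var -> srt (usort Sg)) (VI VO : set var) : Type :=
| fin_trace of seq (asg D vsort (VI `|` VO)) & asg D vsort VO
| inf_trace of nat -> asg D vsort (VI `|` VO).

(* The assignment at position [k] if it is defined on all variables, i.e. if
   [k < |pi| - 1]. *)
Definition full_at Sg (D : structure Sg) (var : choiceType)
    (vsort : var -> srt (usort Sg)) (VI VO : set var)
    (pi : trace D vsort VI VO) (k : nat) :
    option (asg D vsort (VI `|` VO)) :=
  match pi with
  | fin_trace l _ => onth l k
  | inf_trace f => Some (f k)
  end.

(* The restriction to the output variables of the assignment at position [k],
   if [k < |pi|]. *)
Definition out_at Sg (D : structure Sg) (var : choiceType)
    (vsort : var -> srt (usort Sg)) (VI VO : set var)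
    (pi : trace D vsort VI VO) (k : nat) : option (asg D vsort VO) :=
  match pi with
  | fin_trace l o => onth (rcons (map (restr (@subsetUr _ VI VO)) l) o) k
  | inf_trace f => Some (restr (@subsetUr _ VI VO) (f k))
  end.

Definition inf_often (P : nat -> Prop) : Prop :=
  forall N, exists2 k, (N <= k)%N & P k.

(* Finiteness of the set of outputs is what makes the frame condition
   /\_(v in VO) v = v' of the composition a first-order formula. *)
Record its (Sg : signature) (var : choiceType)
    (vsort : var -> srt (usort Sg)) := ITS {
  inp : set var;
  out : set var;
  inp_out_disj : inp `&` out = set0;
  out_finite : finite_set out;
  init : formula (vin vsort out);
  trans : formula (vprimed vsort (inp `|` out) out);
  fair : set (formula (vin vsort (inp `|` out)) *
              formula (vin vsort (inp `|` out))) }.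
Arguments fair {Sg var vsort}.

Definition vars Sg (var : choiceType) (vsort : var -> srt (usort Sg))
  (M : its vsort) : set var := inp M `|` out M.

Definition lang Sg (D : structure Sg) (var : choiceType)
    (vsort : var -> srt (usort Sg)) (M : its vsort) :
    set (trace D vsort (inp M) (out M)) :=
  [set pi |
    [/\ forall s0, out_at pi 0 = Some s0 -> sat s0 (init M),
        forall k s s', full_at pi k = Some s -> out_at pi k.+1 = Some s' ->
          sat (vjoin s s') (trans M) &
        forall f, pi = inf_trace f -> forall p, fair M p ->
          inf_often (fun k => sat (f k) p.1) ->
          inf_often (fun k => sat (f k) p.2)]].
Arguments lang {Sg} D {var vsort} M.

Definition compatible Sg (var : choiceType) (vsort : var -> srt (usort Sg))
    (n : nat) (M : 'I_n -> its vsort) : Prop :=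
  forall i j, i != j ->
    vars (M i) `&` vars (M j) =
    (out (M i) `&` inp (M j)) `|` (inp (M i) `&` out (M j)).

Record fresh Sg (var : choiceType) (vsort : var -> srt (usort Sg))
    (n : nat) (M : 'I_n -> its vsort) (run stop : 'I_n -> var) : Prop := Fresh {
  run_bool : forall j, vsort (run j) = SBool;
  stop_bool : forall j, vsort (stop j) = SBool;
  run_inj : injective run;
  stop_inj : injective stop;
  run_stop : forall j k, run j <> stop k;
  run_fresh : forall j k, ~ vars (M k) (run j);
  stop_fresh : forall j k, ~ vars (M k) (stop j) }.

Definition shared Sg (var : choiceType) (vsort : var -> srt (usort Sg))
    (n : nat) (M : 'I_n -> its vsort) : set var :=
  \bigcup_(p in [set p : 'I_n * 'I_n | (p.1 < p.2)%N])
    (vars (M p.1) `&` vars (M p.2)).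

Definition comp_inp Sg (var : choiceType) (vsort : var -> srt (usort Sg))
    (n : nat) (M : 'I_n -> its vsort) (run : 'I_n -> var) : set var :=
  (\bigcup_j (inp (M j) `|` [set run j])) `\` shared M.

Definition comp_out Sg (var : choiceType) (vsort : var -> srt (usort Sg))
    (n : nat) (M : 'I_n -> its vsort) (stop : 'I_n -> var) : set var :=
  (\bigcup_j (out (M j) `|` [set stop j])) `|` shared M.

Definition comp_vars Sg (var : choiceType) (vsort : var -> srt (usort Sg))
    (n : nat) (M : 'I_n -> its vsort) (run stop : 'I_n -> var) : set var :=
  comp_inp M run `|` comp_out M stop.

Lemma sub_comp_out Sg (var : choiceType) (vsort : var -> srt (usort Sg))
    n (M : 'I_n -> its vsort) (stop : 'I_n -> var) j :
  out (M j) `<=` comp_out M stop.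
Proof. by move=> x Mx; left; exists j => //; left. Qed.

Lemma stop_comp_out Sg (var : choiceType) (vsort : var -> srt (usort Sg))
    n (M : 'I_n -> its vsort) (stop : 'I_n -> var) j :
  comp_out M stop (stop j).
Proof. by left; exists j => //; right. Qed.

Lemma sub_comp_vars Sg (var : choiceType) (vsort : var -> srt (usort Sg))
    n (M : 'I_n -> its vsort) (run stop : 'I_n -> var) j :
  vars (M j) `<=` comp_vars M run stop.
Proof.
move=> x [Mx|Mx]; last by right; exact: sub_comp_out Mx.
have [Wx|Wx] := pselect (shared M x); first by right; right.
by left; split=> //; exists j => //; left.
Qed.

Lemma run_comp_vars Sg (var : choiceType) (vsort : var -> srt (usort Sg))
    n (M : 'I_n -> its vsort) (run stop : 'I_n -> var) j :
  comp_vars M run stop (run j).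
Proof.
have [Wx|Wx] := pselect (shared M (run j)); first by right; right.
by left; split=> //; exists j => //; right.
Qed.

Lemma stop_comp_vars Sg (var : choiceType) (vsort : var -> srt (usort Sg))
    n (M : 'I_n -> its vsort) (run stop : 'I_n -> var) j :
  comp_vars M run stop (stop j).
Proof. by right; exact: stop_comp_out. Qed.

Lemma comp_disj Sg (var : choiceType) (vsort : var -> srt (usort Sg))
    n (M : 'I_n -> its vsort) (run stop : 'I_n -> var) :
  fresh M run stop -> comp_inp M run `&` comp_out M stop = set0.
Proof.
move=> fr; rewrite -subset0 => x [[[j _ xj] nWx] [[k _ xk]|//]].
case: xj xk => [xj|->] [xk|xk].
- have [jk|jk|jk] := ltngtP j k.
  + by apply: nWx; exists (j, k) => //; split; [left|right].
  + by apply: nWx; exists (k, j) => //; split; [right|left].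
  + have := inp_out_disj (M j); rewrite -subset0; apply; split; first exact: xj.
    by rewrite (ord_inj jk).
- by apply: (@stop_fresh _ _ _ _ _ _ _ fr k j); left; rewrite -xk.
- by apply: (@run_fresh _ _ _ _ _ _ _ fr j k); right.
- exact: (@run_stop _ _ _ _ _ _ _ fr j k).
Qed.

Lemma comp_out_finite Sg (var : choiceType) (vsort : var -> srt (usort Sg))
    n (M : 'I_n -> its vsort) (stop : 'I_n -> var) :
  compatible M -> finite_set (comp_out M stop).
Proof.
move=> cM; set A := \bigcup_j (out (M j) `|` [set stop j]).
have Afin : finite_set A.
  apply: bigcup_finite => // j _; rewrite finite_setU; split=> //.
  exact: out_finite.
apply: (@sub_finite_set _ _ A) => // x [//|[[j k] /= jk]].
have jDk : j != k by rewrite -val_eqE neq_ltn jk.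
rewrite [X in X -> _](congr1 (@^~ x) (cM _ _ jDk)) => -[] [Mj Mk].
  by exists j => //; left.
by exists k => //; left.
Qed.

Definition fbvar Sg (var : choiceType) (vsort : var -> srt (usort Sg))
    (U : set var) (v : var) (Uv : U v) (vb : vsort v = SBool) :
    formula (vin vsort U) := fatom (tvar (Vin v Uv vb)).

Definition fbcur Sg (var : choiceType) (vsort : var -> srt (usort Sg))
    (U W : set var) (v : var) (Uv : U v) (vb : vsort v = SBool) :
    formula (vprimed vsort U W) := fatom (tvar (inl (Vin v Uv vb))).

Definition fbnext Sg (var : choiceType) (vsort : var -> srt (usort Sg))
    (U W : set var) (v : var) (Wv : W v) (vb : vsort v = SBool) :
    formula (vprimed vsort U W) := fatom (tvar (inr (Vin v Wv vb))).

Lemma fset_set_mem (T : choiceType) (A : set T) (Afin : finite_set A)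
  (v : fset_set A) : A (val v).
Proof. by apply/set_mem; rewrite -in_fset_set //; exact: valP. Qed.

Definition fframe Sg (var : choiceType) (vsort : var -> srt (usort Sg))
    (U W A : set var) (Afin : finite_set A) (AU : A `<=` U) (AW : A `<=` W) :
    formula (vprimed vsort U W) :=
  \big[@fand _ _/ftrue]_(v : fset_set A)
    feq (tvar (inl (Vin (val v) (AU _ (fset_set_mem Afin v)) erefl)))
        (tvar (inr (Vin (val v) (AW _ (fset_set_mem Afin v)) erefl))).

Definition comp_init Sg (var : choiceType) (vsort : var -> srt (usort Sg))
    (n : nat) (M : 'I_n -> its vsort) (stop : 'I_n -> var) :
    formula (vin vsort (comp_out M stop)) :=
  \big[@fand _ _/ftrue]_(j < n)
    frename (@vin_sub _ _ _ _ _ (@sub_comp_out _ _ _ _ M stop j)) (init (M j)).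

Definition comp_trans Sg (var : choiceType) (vsort : var -> srt (usort Sg))
    (n : nat) (M : 'I_n -> its vsort) (run stop : 'I_n -> var)
    (fr : fresh M run stop) :
    formula (vprimed vsort (comp_vars M run stop) (comp_out M stop)) :=
  \big[@fand _ _/ftrue]_(j < n)
    let runj := fbcur _ (run_comp_vars M run stop j) (run_bool fr j) in
    let endj := fbcur _ (stop_comp_vars M run stop j) (stop_bool fr j) in
    let endj' := fbnext _ (stop_comp_out M stop j) (stop_bool fr j) in
    fand (fimp runj
           (frename (vprimed_sub (@sub_comp_vars _ _ _ _ M run stop j)
                                 (@sub_comp_out _ _ _ _ M stop j))
                    (trans (M j))))
    (fand (fimp (fnot runj)
           (fframe _ (out_finite (M j))
              (subset_trans (@subsetUr _ (inp (M j)) (out (M j)))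
                            (@sub_comp_vars _ _ _ _ M run stop j))
              (@sub_comp_out _ _ _ _ M stop j)))
          (fiff endj (fand endj' (fnot runj)))).

Definition comp_fair Sg (var : choiceType) (vsort : var -> srt (usort Sg))
    (n : nat) (M : 'I_n -> its vsort) (run stop : 'I_n -> var)
    (fr : fresh M run stop) :
    set (formula (vin vsort (comp_vars M run stop)) *
         formula (vin vsort (comp_vars M run stop))) :=
  \bigcup_j
    let runj := fbvar (run_comp_vars M run stop j) (run_bool fr j) in
    let endj := fbvar (stop_comp_vars M run stop j) (stop_bool fr j) in
    let lift :=
      frename (@vin_sub _ _ _ _ _ (@sub_comp_vars _ _ _ _ M run stop j)) in
    [set (ftrue, for_ runj endj)] `|`
    [set (fand runj (lift p.1), fand runj (lift p.2)) | p in fair (M j)].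

Definition compose Sg (var : choiceType) (vsort : var -> srt (usort Sg))
    (n : nat) (M : 'I_n -> its vsort) (run stop : 'I_n -> var)
    (cM : compatible M) (fr : fresh M run stop) : its vsort :=
  {| inp := comp_inp M run;
     out := comp_out M stop;
     inp_out_disj := comp_disj fr;
     out_finite := comp_out_finite stop cM;
     init := comp_init M stop;
     trans := comp_trans fr;
     fair := comp_fair fr |}.

(* The value is junk if no position [>= m] satisfies [P]. *)
Definition next_pos (P : nat -> bool) (m : nat) : nat :=
  xget 0%N [set r | [/\ (m <= r)%N, P r & forall q, (m <= q < r)%N -> ~~ P q]].

(* The increasing enumeration r_0 < r_1 < ... of the positions satisfying [P],
   when there are infinitely many of them. *)
Fixpoint enum_pos (P : nat -> bool) (k : nat) : nat :=
  next_pos P (if k is k'.+1 then (enum_pos P k').+1 else 0%N).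

Lemma next_posP (P : nat -> bool) m : inf_often P ->
  [/\ (m <= next_pos P m)%N, P (next_pos P m) &
      forall q, (m <= q < next_pos P m)%N -> ~~ P q].
Proof.
move=> /(_ m)[k mk Pk]; rewrite /next_pos.
set A := [set r | _]; apply: (@xgetPex _ 0%N A).
have ex : exists r, (m <= r)%N && P r by exists k; rewrite mk Pk.
exists (ex_minn ex); case: ex_minnP => r /andP[mr Pr] rmin; split=> // q.
move=> /andP[mq qr]; apply/negP => Pq.
by have := rmin q; rewrite mq Pq leqNgt qr => /(_ isT).
Qed.

Lemma enum_posP (P : nat -> bool) : inf_often P ->
  (forall k, (enum_pos P k < enum_pos P k.+1)%N) /\
  (forall r, P r <-> exists k, enum_pos P k = r).
Proof.
move=> infP; have inc k : (enum_pos P k < enum_pos P k.+1)%N.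
  by have [] := next_posP (enum_pos P k).+1 infP.
split=> // r; split=> [Pr|[k <-]]; last first.
  case: k => [|k]; first by have [] := next_posP 0 infP.
  by have [] := next_posP (enum_pos P k).+1 infP.
have kle k : (k <= enum_pos P k)%N.
  by elim: k => // k IH; exact: (leq_ltn_trans IH (inc k)).
have ex : exists k, (r <= enum_pos P k)%N by exists r.
exists (ex_minn ex); case: ex_minnP => k rk kmin.
apply/eqP; rewrite eqn_leq rk andbT leqNgt; apply/negP => rlt.
case: k => [|k] in rk kmin rlt *.
  by have [_ _ /(_ r)] := next_posP 0 infP; rewrite Pr => /(_ rlt).
have [_ _ /(_ r)] := next_posP (enum_pos P k).+1 infP; rewrite Pr.
have klt : (enum_pos P k < r)%N.
  by rewrite ltnNge; apply/negP => /kmin; rewrite ltnn.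
by rewrite klt => /(_ rlt).
Qed.

Definition pos_below (P : nat -> bool) (b : nat) : seq nat :=
  [seq k <- iota 0 b | P k].

(* [r_(N-1) + 1] for the sequence r_0 ... r_(N-1), and [0] if [N = 0]. *)
Definition last_succ (rs : seq nat) : nat := last 0%N (map S rs).

(* The value is junk if [P] holds infinitely often. *)
Definition bound_pos (P : nat -> bool) : nat :=
  xget 0%N [set b | forall k, (b <= k)%N -> ~~ P k].

Definition runs Sg (D : structure Sg) (var : choiceType)
    (vsort : var -> srt (usort Sg)) (n : nat) (M : 'I_n -> its vsort)
    (run stop : 'I_n -> var) (fr : fresh M run stop) (i : 'I_n)
    (s : asg D vsort (comp_vars M run stop)) : bool :=
  s SBool (Vin (run i) (run_comp_vars M run stop i) (run_bool fr i)).

Definition Pr Sg (D : structure Sg) (var : choiceType)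
    (vsort : var -> srt (usort Sg)) (n : nat) (M : 'I_n -> its vsort)
    (run stop : 'I_n -> var) (fr : fresh M run stop) (i : 'I_n)
    (pi : trace D vsort (comp_inp M run) (comp_out M stop)) :
    trace D vsort (inp (M i)) (out (M i)) :=
  let resV := restr (@sub_comp_vars _ _ _ _ M run stop i) in
  let resO := restr (@sub_comp_out _ _ _ _ M stop i) in
  let toO := restr (@subsetUr _ (comp_inp M run) (comp_out M stop)) in
  match pi with
  | fin_trace l o =>
      let P k := nth false (map (runs fr i) l) k in
      let m := last_succ (pos_below P (size l)) in
      (* [nth] falls back on the last assignment [o] when [m = size l]. *)
      fin_trace [seq resV s | s <- l & runs fr i s] (resO (nth o (map toO l) m))
  | inf_trace f =>
      let P k := runs fr i (f k) in
      if `[< inf_often P >] then inf_trace (fun k => resV (f (enum_pos P k)))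
      else
        let rs := pos_below P (bound_pos P) in
        fin_trace [seq resV (f k) | k <- rs] (resO (toO (f (last_succ rs))))
  end.

(* Main.v *)
(* While component [i] is not scheduled, the frame condition keeps its outputs
   unchanged. Hence, at a selected position, they still have the values that
   were produced right after the previous selected position, so consecutive
   assignments of the projection satisfy [trans (M i)], and the first one
   satisfies [init (M i)]. The fairness pairs of the composition only test
   [f_A] and [f_G] at selected positions, where they are fairness of the
   projection. *)
Require Import Defs.
From HB Require Import structures.
From mathcomp Require Import all_boot finmap.
From mathcomp Require Import all_classical.

Set Implicit Arguments.
Unset Strict Implicit.
Unset Printing Implicit Defensive.

Local Open Scope classical_set_scope.

(** * Semantics of renaming and of finite conjunctions *)

Lemma eval_trename Sg (D : structure Sg) (X Y : srt (usort Sg) -> Type)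
    (h : forall s, X s -> Y s) (rho : valuation D Y) s (t : term X s) :
  eval rho (trename h t) = eval (fun s x => rho s (h s x)) t.
Proof.
elim: t => //= f a IH; congr fint.
by apply: functional_extensionality_dep => j; exact: IH.
Qed.

Lemma vext_ext_map Sg (D : structure Sg) (X Y : srt (usort Sg) -> Type)
    (h : forall s, X s -> Y s) (rho : valuation D Y) s (d : dom D s) :
  (fun t x => vext rho d (ext_map h x)) = vext (fun s x => rho s (h s x)) d.
Proof.
apply: functional_extensionality_dep => t.
by apply: functional_extensionality_dep; case.
Qed.

(** Induction on [p], with [Y], [h] and [rho] generalized because a quantifier extends both variable
    families; [vext_ext_map] then matches the extended valuations. Equality of propositions, rather
    than equivalence, allows rewriting. *)
Lemma sat_frename Sg (D : structure Sg) (X Y : srt (usort Sg) -> Type)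
    (h : forall s, X s -> Y s) (rho : valuation D Y) (p : formula X) :
  sat rho (frename h p) = sat (fun s x => rho s (h s x)) p.
Proof.
elim: p Y h rho => {X} //= [X t|X s t u|X p IH|X p IHp q IHq|X p IHp q IHq
  |X p IHp q IHq|X s p IH|X s p IH] Y h rho; rewrite ?eval_trename ?IH ?IHp ?IHq //.
- by apply: eq_forall => d; rewrite IH vext_ext_map.
- by apply: eq_exists => d; rewrite IH vext_ext_map.
Qed.

Lemma sat_big_fand Sg (D : structure Sg) (X : srt (usort Sg) -> Type)
    (rho : valuation D X) (I : finType) (F : I -> formula X) :
  sat rho (\big[@fand _ _/ftrue]_j F j) -> forall j, sat rho (F j).
Proof.
move=> Fs j; have: j \in index_enum I by rewrite mem_index_enum.
move: Fs; elim: (index_enum I) => // k s IH; rewrite big_cons => -[Fk Fs].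
by rewrite in_cons => /predU1P[->//|]; exact: IH.
Qed.

(** * Restriction of assignments and positions of traces *)

Section Assignments.
Context {Sg : signature} {D : structure Sg} {var : choiceType}.
Context {vsort : var -> srt (usort Sg)}.

(** The membership proofs stored in variables are irrelevant, so any proof [UW] of the inclusion may
    be used, not only the composite of [UV] and [VW]. *)
Lemma restr_comp (U V W : set var) (UV : U `<=` V) (VW : V `<=` W)
    (UW : U `<=` W) (s : asg D vsort W) :
  restr UV (restr VW s) = restr UW s.
Proof.
apply: functional_extensionality_dep => t.
apply: functional_extensionality_dep => x.
by rewrite /restr /vin_sub /=; congr (s t (Vin _ _ _)); exact: Prop_irrelevance.
Qed.

Lemma restr_restr (U V V' W : set var) (UV : U `<=` V) (VW : V `<=` W)
    (UV' : U `<=` V') (VW' : V' `<=` W) (s : asg D vsort W) :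
  restr UV (restr VW s) = restr UV' (restr VW' s).
Proof. by rewrite !(restr_comp _ _ (subset_trans UV VW)). Qed.

Lemma vjoin_vprimed_sub (U U' W W' : set var) (UU' : U `<=` U')
    (WW' : W `<=` W') (s : asg D vsort U') (s' : asg D vsort W') :
  (fun t x => vjoin s s' (vprimed_sub UU' WW' x)) =
  vjoin (restr UU' s) (restr WW' s').
Proof.
apply: functional_extensionality_dep => t.
by apply: functional_extensionality_dep; case.
Qed.

Lemma sat_fframe (U W A : set var) (Afin : finite_set A) (AU : A `<=` U)
    (AW : A `<=` W) (s : asg D vsort U) (s' : asg D vsort W) :
  sat (vjoin s s') (fframe vsort Afin AU AW) -> restr AU s = restr AW s'.
Proof.
move=> /sat_big_fand H; apply: functional_extensionality_dep => t.
apply: functional_extensionality_dep => -[v Av vt]; subst t.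
(* After [subst t] the sort equation is [erefl], as in [fframe], so only the membership proofs still
   differ. *)
have vA : v \in fset_set A by rewrite in_fset_set // inE.
move: (H [` vA]%fset) => /= {}H; rewrite /restr /vin_sub /=.
by rewrite (Prop_irrelevance (AU v Av) (AU v (fset_set_mem Afin [` vA]%fset)))
           (Prop_irrelevance (AW v Av) (AW v (fset_set_mem Afin [` vA]%fset))).
Qed.

Lemma full_out (VI VO : set var) (pi : trace D vsort VI VO) k s :
  full_at pi k = Some s -> out_at pi k = Some (restr (@subsetUr _ VI VO) s).
Proof.
case: pi => [l o|f] /=; last by case=> ->.
by elim: l k => [|x l IH] [|k] //=; [case=> ->|exact: IH].
Qed.

(** Only the last assignment of a finite trace lacks inputs, and a position with a successor is not
    the last. *)
Lemma out_full (VI VO : set var) (pi : trace D vsort VI VO) k o :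
  out_at pi k.+1 = Some o -> exists s, full_at pi k = Some s.
Proof.
case: pi => [l o'|f] /=; last by exists (f k).
elim: l k => [|x l IH] [|k] //=; [by exists x|exact: IH].
Qed.

Lemma out_at_le (VI VO : set var) (pi : trace D vsort VI VO) a b o :
  (a <= b)%N -> out_at pi b = Some o -> exists o', out_at pi a = Some o'.
Proof.
move=> /subnKC <-; elim: (b - a)%N o => [|d IH] o; first by rewrite addn0; exists o.
by rewrite addnS => /out_full[s /full_out]; exact: IH.
Qed.

End Assignments.

(** * Gaps between selected positions *)

Definition succ_prev (r : nat -> nat) (k : nat) : nat :=
  if k is k'.+1 then (r k').+1 else 0%N.

(** The default of [nth] is [last_succ rs], so the index [size rs] denotes the position of the final
    outputs, whose gap is empty. For smaller [k], a selected position inside the gap would be an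
    entry of the increasing list [rs] strictly between two consecutive entries, or before the first
    one. *)
Lemma pos_below_gap (P : nat -> bool) (b k : nat) :
  let rs := pos_below P b in let r := nth (last_succ rs) rs in
  (k <= size rs)%N ->
  (succ_prev r k <= r k)%N /\
  forall q, (succ_prev r k <= q < r k)%N -> ~~ P q.
Proof.
move=> rs r; have rs_sorted : sorted ltn rs.
  by apply: sorted_filter; [exact: ltn_trans|exact: iota_ltn_sorted].
rewrite leq_eqVlt => /predU1P[->|ks].
  suff -> : succ_prev r (size rs) = r (size rs).
    by split=> // q; case: ltngtP.
  rewrite /r /succ_prev nth_default // /last_succ.
  (* For empty [rs] both sides are 0. *)
  case: (lastP rs) => // s x; rewrite size_rcons map_rcons last_rcons.
  by rewrite nth_rcons ltnn eqxx.
have rmono j l : (j < l)%N -> (l < size rs)%N -> (r j < r l)%N.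
  by move=> jl lk; apply: (sorted_ltn_nth ltn_trans) => //; exact: ltn_trans lk.
split=> [|q /andP[kq qk]]; first by case: k ks => //= k ks; exact: rmono.
apply/negP => Pq; have : r k \in rs by exact: mem_nth.
rewrite mem_filter mem_iota add0n => /and3P[_ _ rkb].
have : q \in rs by rewrite mem_filter mem_iota Pq /= (ltn_trans qk).
move=> /(nthP (last_succ rs))[j js]; rewrite -/(r j) => rj.
have jk : (j < k)%N.
  rewrite ltnNge leq_eqVlt; apply/negP => /predU1P[kj|/rmono/(_ js)].
    by rewrite -rj -kj ltnn in qk.
  by rewrite rj ltnNge ltnW.
case: k ks kq jk {qk rkb} => //= k ks kq; rewrite ltnS leq_eqVlt => /predU1P[jk|jk].
  by rewrite -rj jk ltnn in kq.
by have := rmono _ _ jk (ltnW ks); rewrite rj ltnNge ltnW.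
Qed.

Lemma last_succ_pos_below (P : nat -> bool) (b : nat) :
  (last_succ (pos_below P b) <= b)%N.
Proof.
rewrite /last_succ; have: {subset pos_below P b <= iota 0 b}.
  exact: mem_subseq (filter_subseq _ _).
case: (lastP (pos_below P b)) => // s x; rewrite map_rcons last_rcons.
by move=> /(_ x); rewrite mem_rcons mem_head mem_iota => /(_ isT).
Qed.

Lemma onth_lt (T : Type) (s : seq T) k x : onth s k = Some x -> (k < size s)%N.
Proof. by rewrite -onthTE => ->. Qed.

Lemma onth_size (T : Type) (d : T) (s : seq T) k :
  (k < size s)%N -> onth s k = Some (nth d s k).
Proof. by move=> ks; rewrite onthE (nth_map d). Qed.

Lemma onth_rcons (T : Type) (s : seq T) x k :
  onth (rcons s x) k = if k == size s then Some x else onth s k.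
Proof. by elim: s k => [|y s IH] [|k] //=; rewrite ?onth0n. Qed.

(** Listing [l] as the values of [nth d l] on [iota 0 (size l)] turns filtering entries into
    filtering indices. *)
Lemma filter_pos_below (T : Type) (d : T) (p : pred T) (l : seq T) :
  [seq s <- l | p s] =
  map (nth d l) (pos_below (nth false (map p l)) (size l)).
Proof.
rewrite -[in LHS](mkseq_nth d l) /mkseq filter_map /pos_below; congr map.
by apply: eq_in_filter => k; rewrite mem_iota => /andP[_ kl]; rewrite (nth_map d).
Qed.

Lemma size_filter_pos_below (T : Type) (p : pred T) (l : seq T) :
  size [seq s <- l | p s] = size (pos_below (nth false (map p l)) (size l)).
Proof. by case: l => // x l; rewrite (filter_pos_below x) size_map. Qed.

Lemma onth_filter_pos_below (T : Type) (p : pred T) (l : seq T) k b :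
  let rs := pos_below (nth false (map p l)) (size l) in
  (k < size rs)%N -> onth [seq s <- l | p s] k = onth l (nth b rs k).
Proof.
move=> rs; case: l @rs => // x l; set l' := x :: l => rs ks.
rewrite (filter_pos_below x) onth_map (onth_size b ks) /= (onth_size x) //.
by have := mem_nth b ks; rewrite mem_filter mem_iota => /and3P[].
Qed.

Lemma onth_rcons_map (T U : Type) (h : T -> U) (s : seq T) x k y :
  onth (rcons (map h s) x) k = Some y ->
  (exists2 z, onth s k = Some z & h z = y) \/ (k = size s /\ x = y).
Proof.
rewrite onth_rcons size_map onth_map; case: eqP => [-> [->]|_]; first by right.
by case: onth => // z [<-]; left; exists z.
Qed.

(** * Traces of the composition seen from component [i] *)

Section Projection.
Context {Sg : signature} {D : structure Sg} {var : choiceType}.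
Context {vsort : var -> srt (usort Sg)} {n : nat} {M : 'I_n -> its vsort}.
Context {run stop : 'I_n -> var}.
Variables (cM : compatible M) (fr : fresh M run stop) (i : 'I_n).
Variable pi : trace D vsort (comp_inp M run) (comp_out M stop).
Hypothesis pi_lang : lang D (compose cM fr) pi.

Local Notation resV := (restr (@sub_comp_vars _ _ _ _ M run stop i)).
Local Notation resO := (restr (@sub_comp_out _ _ _ _ M stop i)).

Lemma lang_compose_init o :
  out_at pi 0 = Some o -> sat (resO o) (init (M i)).
Proof.
have [pi_init _ _] := pi_lang; move=> /pi_init /sat_big_fand /(_ i) /=.
by rewrite sat_frename.
Qed.

Lemma lang_compose_step k s o :
  full_at pi k = Some s -> out_at pi k.+1 = Some o -> runs fr i s ->
  sat (vjoin (resV s) (resO o)) (trans (M i)).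
Proof.
have [_ pi_trans _] := pi_lang => sk ok srun.
have /sat_big_fand /(_ i) /= [+ _] := pi_trans _ _ _ sk ok.
by move=> /(_ srun); rewrite sat_frename vjoin_vprimed_sub.
Qed.

Lemma lang_compose_idle k s o :
  full_at pi k = Some s -> out_at pi k.+1 = Some o -> ~~ runs fr i s ->
  resO (restr (@subsetUr _ _ _) s) = resO o.
Proof.
have [_ pi_trans _] := pi_lang => sk ok /negP srun.
have /sat_big_fand /(_ i) /= [_ [+ _]] := pi_trans _ _ _ sk ok.
move=> /(_ srun) /sat_fframe <-; exact: restr_comp.
Qed.

(** Induction on [b - a]: since the trace reaches [b], every earlier position carries a full
    assignment, so the frame condition applies at each step. *)
Lemma lang_compose_idle_interval a b oa ob :
  (a <= b)%N -> out_at pi a = Some oa -> out_at pi b = Some ob ->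
  (forall q, (a <= q < b)%N -> ~~ oapp (runs fr i) false (full_at pi q)) ->
  resO oa = resO ob.
Proof.
move=> /subnKC <-; move: (b - a)%N => d oaE.
elim: d ob => [|d IH] ob; first by rewrite addn0 oaE => -[->].
rewrite addnS => obE idle; have [s sE] := out_full obE.
have -> : resO oa = resO (restr (@subsetUr _ _ _) s).
  apply: IH (full_out sE) _ => q /andP[aq qd].
  by apply: idle; rewrite aq ltnS ltnW.
apply: (lang_compose_idle sE obE).
by have := idle (a + d)%N; rewrite leq_addr ltnSn sE; exact.
Qed.

(* The gap condition makes the outputs at [r k] equal to those right after the
   previous selected position, which is what [trans (M i)] constrains. *)
Lemma lang_compose_subtrace (tau : trace D vsort (inp (M i)) (out (M i)))
    (r : nat -> nat) :
  (forall k s, full_at tau k = Some s ->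
    exists s', [/\ full_at pi (r k) = Some s', resV s' = s & runs fr i s']) ->
  (forall k o, out_at tau k = Some o ->
    [/\ exists2 o', out_at pi (r k) = Some o' & resO o' = o,
        (succ_prev r k <= r k)%N &
        forall q, (succ_prev r k <= q < r k)%N ->
          ~~ oapp (runs fr i) false (full_at pi q)]) ->
  (forall f, tau = inf_trace f -> forall p, fair (M i) p ->
    inf_often (fun k => sat (f k) p.1) -> inf_often (fun k => sat (f k) p.2)) ->
  lang D (M i) tau.
Proof.
move=> tau_full tau_out tau_fair.
have outE k o : out_at tau k = Some o ->
    exists2 o', out_at pi (succ_prev r k) = Some o' & resO o' = o.
  move=> /tau_out[[o' o'E <-] ler gap]; have [o1 o1E] := out_at_le ler o'E.
  by exists o1 => //; exact: lang_compose_idle_interval ler o1E o'E gap.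
split=> // [s0 /outE[o' o'E <-]|k s o /tau_full[s' [s'E <- s'run]] /outE[o' o'E <-]].
  exact: lang_compose_init.
exact: lang_compose_step s'E o'E s'run.
Qed.

End Projection.

Theorem theorem4p8 (Sg : signature) (D : structure Sg)
    (var : choiceType) (vsort : var -> srt (usort Sg))
    (n : nat) (M : 'I_n -> its vsort) (cM : compatible M)
    (run stop : 'I_n -> var) (fr : fresh M run stop) (i : 'I_n) :
  [set Pr fr i pi | pi in lang D (compose cM fr)] `<=` lang D (M i).
Proof.
move=> _ [pi pi_lang <-]; case: pi pi_lang => [l o|f] pi_lang.
  (* Finite trace. The default [false] makes the last position, where [run i] need not be defined,
     count as not selected. *)
  pose P := nth false (map (runs fr i) l); pose rs := pos_below P (size l).
  have Pfull q : oapp (runs fr i) false (onth l q) = P q.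
    by rewrite /P -odflt_onth onth_map; case: onth.
  have fullE k s : onth [seq s <- l | runs fr i s] k = Some s ->
      onth l (nth (last_succ rs) rs k) = Some s /\ runs fr i s.
    move=> sE; have ks : (k < size rs)%N.
      by rewrite -size_filter_pos_below (onth_lt sE).
    move: sE; rewrite (onth_filter_pos_below (last_succ rs) ks) => sE; split=> //.
    have := mem_nth (last_succ rs) ks.
    by rewrite mem_filter -Pfull sE => /andP[].
  apply: (lang_compose_subtrace pi_lang (r := nth (last_succ rs) rs)) => //=.
    move=> k s; rewrite onth_map.
    case sE: onth => [s'|//] [<-]; exists s'.
    by have [] := fullE _ _ sE.
  move=> k s sE; have ks : (k <= size rs)%N.
    by have := onth_lt sE; rewrite size_rcons !size_map size_filter_pos_below.
  have [lek gap] := pos_below_gap ks.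
  split=> // [|q qk]; last by rewrite Pfull; exact: gap.
  case: (onth_rcons_map sE) => [[z + <-]|[kE <-]].
    rewrite onth_map; case s'E: onth => [s'|//] [<-].
    have [{}s'E _] := fullE _ _ s'E; exists (restr (@subsetUr _ _ _) s').
      exact: (@full_out _ _ _ _ _ _ (fin_trace l o)).
    exact: restr_restr.
  (* The last assignment of the projection: the index runs past [rs], and the default yields the
     required position. *)
  have -> : nth (last_succ rs) rs k = last_succ rs.
    by rewrite nth_default // kE size_map size_filter_pos_below.
  eexists; last by [].
  (* This position is either [size l], where only [o] is available, or the position of a full
     assignment in [l]. *)
  rewrite onth_rcons size_map; case: eqP => [->|/eqP neq].
    by rewrite nth_default // size_map.
  by apply: onth_size; rewrite size_map ltn_neqAle neq last_succ_pos_below.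
rewrite /Pr; case: asboolP => infP.
  (* Infinitely many selected positions: the gaps are those left by [next_pos]. *)
  set P := fun k => runs fr i (f k); have enumP k :
      [/\ (succ_prev (enum_pos P) k <= enum_pos P k)%N, P (enum_pos P k) &
      forall q, (succ_prev (enum_pos P) k <= q < enum_pos P k)%N -> ~~ P q].
    by case: k => [|k]; exact: next_posP infP.
  apply: (lang_compose_subtrace pi_lang (r := enum_pos P)) => /=.
  - by move=> k _ [<-]; exists (f (enum_pos P k)); split=> //; have [] := enumP k.
  - move=> k _ [<-]; have [ler _ gap] := enumP k; split=> //.
    by eexists; [reflexivity|exact: restr_restr].
  - move=> _ [<-] p pfair often1 N.
    have [inc enumE] := enum_posP infP.
    have mono : {homo enum_pos P : a b / (a <= b)%N}.
      by apply: homo_leq => //; [exact: leq_trans|move=> k; exact: ltnW].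
    have kle k : (k <= enum_pos P k)%N.
      by elim: k => // k IH; exact: leq_ltn_trans IH (inc k).
    have [_ _ pi_fair] := pi_lang.
    (* The guarded copy of [p] among the fairness pairs of the composition. *)
    have fairP : comp_fair fr (_, _) :=
      ex_intro2 _ _ i I (or_intror (ex_intro2 _ _ p pfair erefl)).
    (* Searching from [enum_pos P N] on, instead of [N], ensures that the selected position found
       has index at least [N]. *)
    have /= [|r Nr [runr]] := pi_fair f erefl _ fairP _ (enum_pos P N).
      move=> m; have [k mk pk] := often1 m; exists (enum_pos P k).
        exact: leq_trans mk (kle k).
      split; first by have [] := enumP k.
      by rewrite sat_frename.
    rewrite sat_frename => pr; have [k kr] := (enumE r).1 runr.
    exists k; last by rewrite kr.
    (* If [k < N], then [enum_pos P k.+1] is at most [enum_pos P N], hence at most [r], which is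
       [enum_pos P k]; this contradicts strict growth. *)
    rewrite leqNgt; apply/negP => /mono /leq_trans /(_ Nr).
    by rewrite -kr leqNgt inc.
(* An infinite trace with a finite projection: no fairness obligation remains, and the final outputs
   are read at [last_succ rs], again the default of [nth]. *)
set P := fun k => runs fr i (f k); set rs := pos_below P _.
have rsP k q : onth rs k = Some q -> q = nth (last_succ rs) rs k /\ P q.
  move=> qE; rewrite -odflt_onth qE; split=> //.
  by have : q \in rs; [apply/onthP; exists k|rewrite mem_filter => /andP[]].
apply: (lang_compose_subtrace pi_lang (r := nth (last_succ rs) rs)) => //=.
  move=> k s; rewrite onth_map; case qE: onth => [q|//] [<-].
  by have [<- Pq] := rsP _ _ qE; exists (f q).
move=> k s sE; have ks : (k <= size rs)%N.
  by have := onth_lt sE; rewrite size_rcons !size_map.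
have [lek gap] := pos_below_gap ks; split=> //.
eexists; first by [].
case: (onth_rcons_map sE) => [[z + <-]|[kE <-]].
  rewrite onth_map; case qE: onth => [q|//] [<-].
  by have [<- _] := rsP _ _ qE; exact: restr_restr.
by rewrite nth_default // kE size_map.
Qed.
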